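(* Define $\widehat M_n(P)=\{\theta\in\mathbb Z: J_n(\theta)\le n^2\}$. Let $P$ be a unimodal distribution on $\mathbb Z$ (i.e. $P\in\mathcal D_{\mathbb Z}$), let $M(P)$ be its nonempty set of modes, and let $X_1,X_2,\dots$ be i.i.d. with distribution $P$. Then, almost surely, for every bounded subset $B\subseteq\mathbb Z$ there exists $N(B)$ such that for all $n\ge N(B)$, $$\widehat M_n(P)\cap B=M(P)\cap B.$$
   Context: $\mathcal P(\mathbb Z)$ is the set of probability measures on $\mathbb Z$; $f_P(n)=P(\{n\})$; $x^+=\max(x,0)$. For $\theta\in\mathbb Z$, $$\mathcal D_\theta=\{P\in\mathcal P(\mathbb Z): f_P(n-1)\le f_P(n)\text{ if }n\le\theta,\ \text{and } f_P(n)\ge f_P(n+1)\text{ if }n\ge\theta\},$$ $\mathcal D_{\mathbb Z}=\bigcup_{\theta\in\mathbb Z}\mathcal D_\theta$, and $M(P)=\{\theta\in\mathbb Z:P\in\mathcal D_\theta\}$. Despite the notation, $\widehat M_n(P)$ depends only on the data $X_1,\dots,X_n$. For a probability measure $R$ on $\mathbb Z$ and an integer $m\ge0$ define, for $x\in\mathbb Z$, $$E^{R,m}(x)=1+\lambda_{R,m}\big(-\mathbf 1_{\{x=m\}}+\mathbf 1_{\{x=m+1\}}\big),\qquad \lambda_{R,m}=\frac{(f_R(m+1)-f_R(m))^+}{2(f_R(m)+f_R(m+1))},\quad 0/0:=0.$$ Let $\hat Q^{+,\theta}_k$ and $\hat Q^{-,\theta}_k$ be the empirical measures of $X_1-\theta,\dots,X_k-\theta$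 and of $\theta-X_1,\dots,\theta-X_k$ respectively ($k\ge1$), and for $k=0$ interpret $E^{\hat Q^{\pm,\theta}_0,m}\equiv1$. Define $$J_n^{m+}(\theta)=\prod_{k=1}^nE^{\hat Q^{+,\theta}_{k-1},m}(X_k-\theta),\quad J_n^{m-}(\theta)=\prod_{k=1}^nE^{\hat Q^{-,\theta}_{k-1},m}(\theta-X_k),\quad J_n(\theta)=\sum_{m=0}^\infty2^{-m-2}\big(J_n^{m+}(\theta)+J_n^{m-}(\theta)\big).$$ *)

(* Defs.v *)
From HB Require Import structures.
From mathcomp Require Import all_boot all_order all_algebra finmap.
From mathcomp Require Import all_classical all_reals all_analysis.

Set Implicit Arguments.
Unset Strict Implicit.
Unset Printing Implicit Defensive.

Import Order.TTheory GRing.Theory Num.Theory.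

Local Open Scope classical_set_scope.
Local Open Scope ring_scope.

HB.instance Definition _ := isPointed.Build int 0.

(* Every subset of the integers is measurable, as the library does for nat. *)
HB.instance Definition _ := @isMeasurable.Build default_measure_display
  int discrete_measurable discrete_measurable0
  discrete_measurableC discrete_measurableU.

Section iid.
Context d d' (T : measurableType d) (T' : measurableType d') (R : realType).
Variable Pr : probability T R.

Definition mutually_independent (X : nat -> {RV Pr >-> T'}) : Prop :=
  forall (I : {fset nat}) (A : nat -> set T'),
    (forall i, i \in I -> measurable (A i)) ->
    Pr (\bigcap_(i in [set` I]) (X i @^-1` A i)) =
    (\prod_(i <- I) Pr (X i @^-1` A i))%E.

Definition iid (P : probability T' R) (X : nat -> {RV Pr >-> T'}) : Prop :=
  (forall i (A : set T'), measurable A -> distribution Pr (X i) A = P A) /\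
  mutually_independent X.

End iid.

Section unimodal.
Context (R : realType).

Definition pmfZ (P : probability int R) (n : int) : R := fine (P [set n]).

Definition unimodal_at (theta : int) : set (probability int R) :=
  [set P | (forall n, n <= theta -> pmfZ P (n - 1) <= pmfZ P n) /\
           (forall n, theta <= n -> pmfZ P (n + 1) <= pmfZ P n)].

Definition unimodal : set (probability int R) :=
  \bigcup_(theta in [set: int]) unimodal_at theta.

Definition modes (P : probability int R) : set int :=
  [set theta | unimodal_at theta P].

End unimodal.

Section empirical.
Context (R : realType).

(* Sequences are indexed from 0, so [empirical y k] is the empirical measure
   of the k.+1 points y 0, ..., y k. *)
Definition empirical (y : nat -> int) (k : nat) : set int -> \bar R :=
  mscale (k.+1%:R^-1)%:nng (msum (fun i => \d_(y i)) k.+1).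

HB.instance Definition _ (y : nat -> int) (k : nat) :=
  Measure.on (empirical y k).

Lemma empirical_setT (y : nat -> int) (k : nat) :
  empirical y k [set: int] = 1%E.
Proof.
rewrite /empirical /mscale /= /msum.
under eq_bigr do rewrite /= diracE in_setT.
rewrite sumEFin sumr_const card_ord -EFinM.
by rewrite mulVf// pnatr_eq0.
Qed.

HB.instance Definition _ (y : nat -> int) (k : nat) :=
  Measure_isProbability.Build _ _ _ (empirical y k) (empirical_setT y k).

End empirical.

Section confidence_set.
Context (R : realType).

(* The convention 0/0 := 0 is automatic, since 0^-1 = 0 in a field. *)
Definition lambda (Q : probability int R) (m : nat) : R :=
  Num.max (pmfZ Q (m%:Z + 1) - pmfZ Q m%:Z) 0 /
  (2 * (pmfZ Q m%:Z + pmfZ Q (m%:Z + 1))).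

Definition evar (Q : probability int R) (m : nat) (x : int) : R :=
  1 + lambda Q m * (- (x == m%:Z)%:R + (x == m%:Z + 1)%:R).

(* The product of the e-variables along y 0, ..., y (n - 1), each one built
   from the strictly earlier points; the first factor is 1, as there is no
   empirical measure of zero points. *)
Definition eprod (n m : nat) (y : nat -> int) : R :=
  \prod_(0 <= k < n)
    (if k is k'.+1 then evar (empirical R y k') m (y k) else 1).

Definition Jplus (x : nat -> int) (n m : nat) (theta : int) : R :=
  eprod n m (fun k => x k - theta).

Definition Jminus (x : nat -> int) (n m : nat) (theta : int) : R :=
  eprod n m (fun k => theta - x k).

Definition J (x : nat -> int) (n : nat) (theta : int) : \bar R :=
  (\sum_(0 <= m <oo)
    (2 ^- m.+2 * (Jplus x n m theta + Jminus x n m theta))%:E)%E.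

Definition Mhat (x : nat -> int) (n : nat) : set int :=
  [set theta | (J x n theta <= (n%:R ^+ 2)%:E)%E].

End confidence_set.

Definition boundedZ (B : set int) : Prop :=
  exists K : int, forall b, B b -> `|b| <= K.

(* Main.v *)
Require Import Defs.
From HB Require Import structures.
From mathcomp Require Import all_boot all_order all_algebra finmap.
From mathcomp Require Import all_classical all_reals all_analysis.
From mathcomp Require Import measurable_realfun zify ring lra.

Set Implicit Arguments.
Unset Strict Implicit.
Unset Printing Implicit Defensive.

Import Order.TTheory GRing.Theory Num.Theory.
Import numFieldNormedType.Exports.

Local Open Scope classical_set_scope.
Local Open Scope ring_scope.

(** For a mode theta every J_n^{m+-}(theta) is a nonnegative supermartingale
    started at 1: the tuning parameter is a function of the past and nonnegative,
    while the conditional drift of each factor is a nonpositive multiple of it.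
    Hence E J_n(theta) <= 1, and Markov's inequality with Borel-Cantelli gives
    J_n(theta) <= n^2 eventually.

    If theta is not a mode, some adjacent pair of probabilities p < q is in the
    wrong order.  The frequencies converge, so the tuning parameter tends to
    l = (q - p) / (2 (p + q)), and by 1 + x >= exp (x - 3/2 x^2) the logarithm of
    the corresponding product grows at least like
    n (l (q - p) - 3/2 l^2 (p + q)) = n (q - p)^2 / (8 (p + q)),
    which beats n^2.  The law of large numbers used here follows from the
    supermartingale bound itself, applied to the products of
    1 +- (1{X_k = a} - P{a}) / (j + 2). *)

(** * Elementary estimates for real sequences *)

Section real_sequences.
Context (R : realType).

(* Any constant below 2 in place of 3/2 would do for the divergence of the
   e-process; with the constant 2 its drift would vanish. *)
Lemma expR_le_1D (x : R) : `|x| <= 2^-1 -> expR (x - 3 / 2 * x ^+ 2) <= 1 + x.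
Proof.
rewrite ler_norml => /andP[xlb xub].
(* The exponent is halved before applying [1 + z <= expR z]: without the halving the resulting
   polynomial inequality would fail for x below -1/3. *)
have -> : x - 3 / 2 * x ^+ 2 = - (2%:R * (- x / 2 + 3 / 4 * x ^+ 2)) by field.
rewrite expRN expRM_natl.
set z := - x / 2 + 3 / 4 * x ^+ 2.
have z0 : 0 < 1 + z by rewrite /z; nra.
have ez : (1 + z) ^+ 2 <= expR z ^+ 2.
  by rewrite lerXn2r ?nnegrE ?expR_ge1Dx// ltW// (lt_le_trans z0)// expR_ge1Dx.
apply: (@le_trans _ _ ((1 + z) ^+ 2)^-1).
  by rewrite lef_pV2// posrE exprn_gt0// expR_gt0.
suff : 1 <= (1 + x) * (1 + z) ^+ 2.
  by rewrite -ler_pdivrMr ?exprn_gt0// mul1r.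
have -> : (1 + x) * (1 + z) ^+ 2 = 1 + x ^+ 2 *
     (3 / 4 + x - 3 / 16 * x ^+ 2 + 9 / 16 * x ^+ 3) by rewrite /z; field.
rewrite lerDl mulr_ge0 ?sqr_ge0//.
have x2 : x ^+ 2 <= 4^-1 by nra.
have x3 : - 8^-1 <= x ^+ 3 by rewrite exprS; nra.
lra.
Qed.

(** The cubic term of the exponential series alone already beats the square. *)
Lemma near_sqr_lt_expR (a C : R) : 0 < a ->
  \forall n \near \oo, C * n%:R ^+ 2 < expR (a * n%:R).
Proof.
move=> a0; have K0 : 0 < a ^+ 3 / 6 by rewrite divr_gt0// exprn_gt0.
near=> n.
have n0 : 0 <= n%:R :> R by [].
apply: lt_le_trans (expR_ge1Dxn 2 (mulr_ge0 (ltW a0) n0)).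
have -> : (3 `!)%:R = 6 :> R by [].
apply: (@le_lt_trans _ _ ((a * n%:R) ^+ 3 / 6)); last by rewrite ltrDr.
have -> : (a * n%:R) ^+ 3 / 6 = (a ^+ 3 / 6 * n%:R) * n%:R ^+ 2 by ring.
rewrite ler_wpM2r ?sqr_ge0// -ler_pdivrMl//.
by near: n; exact: nbhs_infty_ger.
Unshelve. all: by end_near. Qed.

(** Replacing [u] by its limit leaves the error [(u - l) * v], which tends to 0 because [v] is
    bounded; its Cesàro means then tend to 0 as well. In the application [u] is the tuning parameter
    or a multiple of its square. *)
Lemma arithmetic_mean_mul (u v : R^nat) (l L M : R) :
  (forall n, `|v n| <= M) -> u @ \oo --> l -> arithmetic_mean v @ \oo --> L ->
  arithmetic_mean (u \* v) @ \oo --> l * L.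
Proof.
move=> vM ul vL.
have -> : arithmetic_mean (u \* v) =
  (fun n => l * arithmetic_mean v n + arithmetic_mean ((u - cst l) \* v) n).
  apply/funext => n; rewrite /arithmetic_mean /series /= mulrCA -mulrDr.
  congr (_ * _); rewrite mulr_sumr -big_split/=; apply: eq_bigr => i _.
  by rewrite !fctE; ring.
rewrite -[l * L]addr0; apply: cvgD; first exact: cvgZr.
apply: cesaro.
have ul0 : `|u n - l| * M @[n --> \oo] --> (0 : R).
  rewrite -(mul0r M); apply: cvgMr_tmp; rewrite -(normr0 R).
  by apply: cvg_norm; rewrite -(subrr l); apply: cvgB => //; exact: cvg_cst.
apply: norm_cvg0.
apply: (squeeze_cvgr _ (cvg_cst 0) ul0).
by apply: nearW => n; rewrite normr_ge0 /= normrM ler_wpM2l.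
Qed.

End real_sequences.

(** * The tuning parameter and the growth of the products along a fixed path *)

Section tuning.
Context (R : realType).
Implicit Types (a b c p q : R) (A B : R^nat).

(* Homogeneous of degree 0, so that counts may replace frequencies; zero counts
   give [0], in agreement with the convention for the first factor of [eprod]. *)
Definition lam a b : R := Num.max (b - a) 0 / (2 * (a + b)).

Lemma lam_scale c a b : 0 < c -> lam (c * a) (c * b) = lam a b.
Proof.
move=> c0; rewrite /lam -mulrBr -[X in Num.max _ X](mulr0 c) -maxr_pMr ?ltW//.
by rewrite -mulrDr mulrCA -mulf_div divff ?mul1r// gt_eqF.
Qed.

Lemma lam_ge0 a b : 0 <= a -> 0 <= b -> 0 <= lam a b.
Proof.
by move=> a0 b0; rewrite /lam divr_ge0 ?mulr_ge0 ?addr_ge0// le_max lexx orbT.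
Qed.

Lemma lam_le_half a b : 0 <= a -> 0 <= b -> lam a b <= 2^-1.
Proof.
move=> a0 b0; have [ab0|ab0] := eqVneq (a + b) 0.
  by rewrite /lam ab0 mulr0 invr0 mulr0.
have {}ab0 : 0 < a + b by rewrite lt_neqAle eq_sym ab0 addr_ge0.
by rewrite /lam ler_pdivrMr ?mulr_gt0// mulrA mulVf// mul1r ge_max; lra.
Qed.

Lemma cvg_lam A B p q : 0 < p + q -> A @ \oo --> p -> B @ \oo --> q ->
  lam (A n) (B n) @[n --> \oo] --> lam p q.
Proof.
move=> pq0 Ap Bq; apply: cvgM.
  have E (x : R) : Num.max x 0 = (x + `|x|) / 2.
    by case: (leP x 0) => x0; rewrite ?(ler0_norm x0) ?(gtr0_norm x0); field.
  rewrite E; under eq_fun do rewrite E.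
  apply: cvgMr_tmp; apply: cvgD; first exact: cvgB.
  by apply: cvg_norm; exact: cvgB.
apply: cvgV; first by rewrite mulf_neq0 ?gt_eqF.
by apply: cvgMl_tmp; exact: cvgD.
Qed.

(** [A] and [B] stand for the indicators of hitting two integers. Since [series A k] sums over
    indices strictly below [k], each factor is tuned by the past only. *)
Definition eproc A B (n : nat) : R :=
  \prod_(0 <= k < n) (1 + lam (series A k) (series B k) * (B k - A k)).

Lemma pmfZ_empirical (y : nat -> int) (k : nat) (z : int) :
  pmfZ (empirical R y k) z =
  k.+1%:R^-1 * series (fun i => (y i == z)%:R) k.+1.
Proof.
transitivity
  (fine ((k.+1%:R^-1)%:E * \sum_(i < k.+1) \d_(y i) [set z] : \bar R)%E) => //.
under eq_bigr do rewrite /= diracE.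
rewrite sumEFin -EFinM /series /= big_mkord; congr (_ * _).
by apply: eq_bigr => i _; congr (_%:R); congr nat_of_bool; apply/idP/eqP; rewrite inE.
Qed.

Lemma lambda_empirical (y : nat -> int) (k m : nat) :
  lambda (empirical R y k) m = lam (series (fun i => (y i == m%:Z)%:R) k.+1)
                                   (series (fun i => (y i == m%:Z + 1)%:R) k.+1).
Proof. by rewrite /lambda !pmfZ_empirical -/(lam _ _) lam_scale. Qed.

Lemma eprodE (n m : nat) (y : nat -> int) : eprod R n m y =
  eproc (fun i => (y i == m%:Z)%:R) (fun i => (y i == m%:Z + 1)%:R) n.
Proof.
apply: eq_bigr => -[_|k _].
  by rewrite /series/= !big_geq// /lam subrr maxxx mul0r mul0r addr0.
by rewrite /evar lambda_empirical [- _ + _]addrC.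
Qed.

Lemma JplusE (x : nat -> int) (n m : nat) (theta : int) : Jplus R x n m theta =
  eproc (fun i => (x i == theta + m%:Z)%:R)
        (fun i => (x i == theta + m%:Z + 1)%:R) n.
Proof.
rewrite /Jplus eprodE; congr eproc; apply/funext => i; congr (_%:R);
  congr nat_of_bool; apply/eqP/eqP; lia.
Qed.

Lemma JminusE (x : nat -> int) (n m : nat) (theta : int) : Jminus R x n m theta =
  eproc (fun i => (x i == theta - m%:Z)%:R)
        (fun i => (x i == theta - m%:Z - 1)%:R) n.
Proof.
rewrite /Jminus eprodE; congr eproc; apply/funext => i; congr (_%:R);
  congr nat_of_bool; apply/eqP/eqP; lia.
Qed.

Lemma expR_sum_le_prod (x : R^nat) n : (forall k, `|x k| <= 2^-1) ->
  expR (\sum_(0 <= k < n) (x k - 3 / 2 * x k ^+ 2)) <=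
  \prod_(0 <= k < n) (1 + x k).
Proof.
move=> x2; rewrite expR_sum; apply: ler_prod => k _.
by rewrite expR_ge0 expR_le_1D.
Qed.

(** Disjointness gives [(B k - A k) ^+ 2 = A k + B k], so the quadratic term in the lower bound for
    the logarithm is again governed by frequencies. *)
Definition disjoint_indicators A B :=
  forall k, [/\ A k = 0 \/ A k = 1, B k = 0 \/ B k = 1 & A k * B k = 0].

Lemma lam_series_bounds A B k : disjoint_indicators A B ->
  0 <= lam (series A k) (series B k) <= 2^-1.
Proof.
move=> AB; have A0 i : 0 <= A i by case: (AB i) => -[]-> *.
have B0 i : 0 <= B i by case: (AB i) => _ -[]-> *.
have sA : 0 <= series A k by apply: sumr_ge0.
have sB : 0 <= series B k by apply: sumr_ge0.
by rewrite lam_ge0 ?lam_le_half.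
Qed.

Lemma eproc_ge0 A B n : disjoint_indicators A B -> 0 <= eproc A B n.
Proof.
move=> AB; apply: prodr_ge0 => k _.
have /andP[] := lam_series_bounds k AB; case: (AB k) => -[]-> []-> _; lra.
Qed.

Lemma eproc_large A B p q (C : R) : disjoint_indicators A B -> 0 <= p -> p < q ->
    arithmetic_mean A @ \oo --> p -> arithmetic_mean B @ \oo --> q ->
  \forall n \near \oo, C * n%:R ^+ 2 < eproc A B n.
Proof.
move=> AB p0 pq Ap Bq; set l := lam p q.
have pq0 : 0 < p + q by lra.
pose u k := lam (series A k) (series B k).
have ul : u @ \oo --> l.
  (* The mean at index n is the count of the first n + 1 terms over n + 1; after the shift,
     homogeneity cancels this denominator. *)
  rewrite -cvg_shiftS; have := cvg_lam pq0 Ap Bq.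
  by under eq_fun do rewrite lam_scale//.
have ABl k : `|B k - A k| <= 1 by case: (AB k) => -[]-> []-> _; rewrite ler_norml; lra.
have ABr k : `|B k + A k| <= 2 by case: (AB k) => -[]-> []-> _; rewrite ler_norml; lra.
have mB : arithmetic_mean (fun k => B k - A k) @ \oo --> q - p.
  rewrite (_ : arithmetic_mean _ =
    arithmetic_mean B - arithmetic_mean A); first exact: cvgB.
  by apply/funext => n; rewrite /arithmetic_mean !fctE -mulrBr /series/= sumrB.
have mS : arithmetic_mean (fun k => B k + A k) @ \oo --> q + p.
  rewrite (_ : arithmetic_mean _ =
    arithmetic_mean B + arithmetic_mean A); first exact: cvgD.
  by apply/funext => n; rewrite /arithmetic_mean !fctE -mulrDr /series/= big_split.
have m1 := arithmetic_mean_mul ABl ul mB.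
have u2 : (fun k => 3 / 2 * (u k * u k)) @ \oo --> 3 / 2 * (l * l).
  by apply: cvgMl_tmp; apply: cvgM.
have m2 := arithmetic_mean_mul ABr u2 mS.
have {m1 m2} m12 := @cvgB _ _ _ _ eventually_filter _ _ _ _ m1 m2.
pose x k := u k * (B k - A k).
have E n : (arithmetic_mean (u \* (fun k => B k - A k)) -
  arithmetic_mean ((fun k => 3 / 2 * (u k * u k)) \* (fun k => B k + A k))) n =
  n.+1%:R^-1 * \sum_(0 <= k < n.+1) (x k - 3 / 2 * x k ^+ 2).
  rewrite /arithmetic_mean !fctE -mulrBr /series/= -sumrB; congr (_ * _).
  apply: eq_bigr => k _; rewrite /x; congr (_ - _).
  by case: (AB k) => -[]-> []->; rewrite ?mulr1 => H; ring || lra.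
have xb k : `|x k| <= 2^-1.
  rewrite /x normrM; have /andP[? ?] := lam_series_bounds k AB.
  by rewrite ger0_norm// -[leRHS]mulr1 ler_pM.
have L0 : 0 < l * (q - p) - 3 / 2 * (l * l) * (q + p).
  rewrite /l /lam max_l; last by rewrite subr_ge0 ltW.
  have -> : (q - p) / (2 * (p + q)) * (q - p) -
    3 / 2 * ((q - p) / (2 * (p + q)) * ((q - p) / (2 * (p + q)))) * (q + p) =
    (q - p) ^+ 2 / (8 * (p + q)) by field; lra.
  by rewrite divr_gt0 ?exprn_gt0 ?mulr_gt0 ?subr_gt0.
set L := l * (q - p) - _ in L0 m12.
(* Half the limiting drift is a lower bound that the means eventually exceed. *)
have L20 : 0 < L / 2 by lra.
have H1 : \forall n \near \oo, L / 2 < n.+1%:R^-1 *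
    \sum_(0 <= k < n.+1) (x k - 3 / 2 * x k ^+ 2).
  have LL : L / 2 < L by lra.
  apply: filterS (cvgr_gt _ m12 _ LL) => n; rewrite E; exact.
have [N1 _ {}H1] := H1.
have [N2 _ H2] := near_sqr_lt_expR C L20.
(* A product of n + 1 factors corresponds to the mean at index n, hence the successor of [N1], which
   also excludes the empty product. *)
exists (maxn N1.+1 N2) => // -[|n]; first by rewrite /= geq_max.
rewrite /= geq_max ltnS => /andP[n1 n2].
apply: lt_le_trans (H2 _ n2) _; apply: le_trans (expR_sum_le_prod _ xb).
by rewrite ler_expR -ler_pdivlMr// [leRHS]mulrC ltW//; exact: H1.
Qed.

(** Put m = 1/(j+2) and let D be the signed sum of the deviations of [v] from [p] over n terms. The
    logarithm of the product is at least m D - 3/2 m^2 n and eventually below m^2 n, so D / n is at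
    most 5/2 m. Both signs and all j together give convergence. *)
Lemma arithmetic_mean_cvg_of_eprods (v : R^nat) p :
    (forall k, 0 <= v k <= 1) -> 0 <= p <= 1 ->
    (forall (j : nat) (b : bool), \forall n \near \oo,
      \prod_(0 <= k < n) (1 + (-1) ^+ b * j.+2%:R^-1 * (v k - p)) <= n%:R ^+ 2) ->
  arithmetic_mean v @ \oo --> p.
Proof.
move=> v01 p01 H.
have K (j : nat) (b : bool) : \forall n \near \oo,
    (-1) ^+ b * (arithmetic_mean v n - p) <= 5 / 2 * j.+2%:R^-1.
  pose m : R := j.+2%:R^-1.
  have m0 : 0 < m by rewrite invr_gt0.
  have m2 : m <= 2^-1 by rewrite lef_pV2// ?posrE// ler_nat.
  pose x k := (-1) ^+ b * m * (v k - p).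
  have vp k : `|v k - p| <= 1 by have := v01 k; rewrite ler_norml; lra.
  have xb k : `|x k| <= 2^-1.
    rewrite /x !normrM normrX normrN1 expr1n mul1r gtr0_norm//.
    by rewrite -[leRHS]mulr1 ler_pM// ltW.
  have [N1 _ {}H] := H j b.
  (* The rate m^2 matches the order of the quadratic error: 3/2 + 1 = 5/2. *)
  have [N2 _ H2] := near_sqr_lt_expR 1 (exprn_gt0 2 m0).
  exists (maxn N1 N2) => // n; rewrite /= geq_max => /andP[n1 n2].
  have {H} H := H n.+1 (leqW n1); have {H2} := H2 n.+1 (leqW n2).
  rewrite mul1r => /(le_lt_trans H)/(le_lt_trans (expR_sum_le_prod _ xb)).
  rewrite ltr_expR => {}H.
  have n0 : 0 < n.+1%:R :> R by [].
  have : \sum_(0 <= k < n.+1) (x k - 3 / 2 * m ^+ 2) < m ^+ 2 * n.+1%:R.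
    apply: le_lt_trans H; apply: ler_sum => k _; rewrite lerB// ler_wpM2l//.
    rewrite -real_normK ?num_real// lerXn2r ?nnegrE ?normr_ge0 ?(ltW m0)//.
    by rewrite /x !normrM normrX normrN1 expr1n mul1r gtr0_norm// ler_piMr// ltW.
  rewrite sumrB -mulr_sumr sumrB !sumr_const_nat subn0.
  rewrite -(mulr_natr p) -(mulr_natr (3 / 2 * _)) => K.
  rewrite /arithmetic_mean /series/= -/m -(ler_pM2l (mulr_gt0 n0 m0)).
  move: K; set S := \sum_(0 <= k < n.+1) v k; set N : R := n.+1%:R in n0 * => K.
  rewrite (_ : N * m * _ = (-1) ^+ b * m * (S - p * N)); last by field; rewrite gt_eqF.
  by apply: ltW; nra.
apply/cvgrPdist_le => /= e e0.
have e20 : 0 < 2 / 5 * e by rewrite mulr_gt0.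
have [j _ /(_ j.+1 (leqnSn j)) /= je] := near_infty_natSinv_lt (PosNum e20).
have [N1 _ H1] := K j false; have [N2 _ H2] := K j true.
exists (maxn N1 N2) => // n; rewrite /= geq_max => /andP[/H1 + /H2].
rewrite /= expr0 expr1 mul1r mulN1r distrC ler_norml => K2 K1.
move: (j.+2%:R^-1) (arithmetic_mean v n) je K1 K2 => /= i M *; lra.
Qed.

End tuning.

(** * Expectations as finite sums over words *)

(* The e-processes see the data only through a map to a finite alphabet, so their
   expectations are finite sums over words and independence is used only through
   the probability of a word. *)
Section words.
Context (R : realType) (d : measure_display) (T : measurableType d).
Context (Pr : probability T R) (P : probability int R).
Context (X : nat -> {RV Pr >-> int}) (iidX : iid P X).
Context (C : finType) (c : int -> C).

Definition word (n : nat) (w : T) : seq C := [seq c (X i w) | i <- iota 0 n].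

Definition letter_prob (x : C) : R := fine (P (c @^-1` [set x])).

Lemma letter_prob_ge0 x : 0 <= letter_prob x.
Proof. exact: fine_ge0. Qed.

Lemma measurable_letter i x : measurable (X i @^-1` (c @^-1` [set x])).
Proof. by rewrite -[_ @^-1` _]setTI; exact: measurable_funP. Qed.

Lemma prob_letter i x : Pr (X i @^-1` (c @^-1` [set x])) = (letter_prob x)%:E.
Proof.
rewrite -[LHS]/(distribution Pr (X i) (c @^-1` [set x])) iidX.1//.
by rewrite fineK// fin_num_measure.
Qed.

Lemma size_word n w : size (word n w) = n.
Proof. by rewrite size_map size_iota. Qed.

Lemma word_eq_bigcap n (t : n.-tuple C) :
  [set w | word n w = t] = \bigcap_(i in [set` [fset i in iota 0 n]%fset])
    (X i @^-1` (c @^-1` [set nth (c 0) t i])).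
Proof.
apply/seteqP; split => w /=.
  move=> wt i; rewrite /= !inE mem_iota add0n => /= iltn.
  by rewrite -wt (nth_map 0%N) ?size_iota// nth_iota.
move=> h; apply: (@eq_from_nth _ (c 0)); rewrite ?size_word ?size_tuple// => i ilt.
rewrite (nth_map 0%N) ?size_iota// nth_iota// add0n.
by apply: h; rewrite /= !inE mem_iota.
Qed.

Lemma measurable_word n (t : n.-tuple C) : measurable [set w | word n w = t].
Proof.
rewrite word_eq_bigcap; apply: fin_bigcap_measurable => // i _.
exact: measurable_letter.
Qed.

Lemma prob_word n (t : n.-tuple C) :
  Pr [set w | word n w = t] = (\prod_(x <- t) letter_prob x)%:E.
Proof.
rewrite word_eq_bigcap iidX.2//.
rewrite (perm_big (iota 0 n)) /=; last first.
  by apply: uniq_perm; rewrite ?fset_uniq ?iota_uniq// => i; rewrite !inE.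
under eq_bigr do rewrite prob_letter.
rewrite prodEFin; congr (_%:E).
rewrite [RHS](big_nth (c 0)) size_tuple /index_iota subn0.
by [].
Qed.

(** Exactly one tuple matches the observed word. This form as a simple function yields both
    measurability and the integral. *)
Lemma word_function_sum (G : seq C -> R) n w :
  G (word n w) = \sum_(t : n.-tuple C) G t * \1_[set w | word n w = t] w.
Proof.
have sw : size (word n w) == n by rewrite size_word.
rewrite (bigD1 (Tuple sw))//= indicE mem_set// mulr1 big1 ?addr0// => t tw.
rewrite indicE memNset ?mulr0// => /= wt; case/eqP: tw.
by apply/val_inj; rewrite /= wt.
Qed.

Lemma measurable_word_function (G : seq C -> R) n :
  measurable_fun setT (fun w => G (word n w)).
Proof.
rewrite (_ : (fun _ => _) = fun w =>
  \sum_(t : n.-tuple C) G t * \1_[set w | word n w = t] w); last first.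
  by apply/funext => w; exact: word_function_sum.
apply: measurable_sum => t; apply: measurable_funM => //.
exact/measurable_indicP/measurable_word.
Qed.

Lemma integral_word_function (G : seq C -> R) n : (forall s, 0 <= G s) ->
  (\int[Pr]_w (G (word n w))%:E =
   (\sum_(t : n.-tuple C) G t * \prod_(x <- t) letter_prob x)%:E)%E.
Proof.
move=> G0; under eq_integral do rewrite word_function_sum -sumEFin.
rewrite ge0_integral_sum//=; last 2 first.
  - move=> t; apply/measurable_EFinP; apply: measurable_funM => //.
    exact/measurable_indicP/measurable_word.
  - by move=> t w _; rewrite lee_fin mulr_ge0.
rewrite -sumEFin; apply: eq_bigr => t _.
under eq_integral do rewrite EFinM.
rewrite ge0_integralZl_EFin//; last first.
  apply/measurable_EFinP; exact/measurable_indicP/measurable_word.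
rewrite integral_indic//; last exact: measurable_word.
by rewrite setIT EFinM -prob_word.
Qed.

(** Splitting off the last letter, the newest observation, lets induction on the length follow
    time. *)
Lemma big_tuple_rcons (V : nmodType) (F : seq C -> V) n :
  \sum_(t : n.+1.-tuple C) F t = \sum_(t : n.-tuple C) \sum_(x : C) F (rcons t x).
Proof.
rewrite pair_big/=.
pose h (p : n.-tuple C * C) : n.+1.-tuple C := [tuple of rcons p.1 p.2].
pose g (t : n.+1.-tuple C) : n.-tuple C * C :=
  ([tuple of belast (thead t) (behead t)], last (thead t) (behead t)).
rewrite (reindex h)//=; exists g => [[t x] _|t _].
  rewrite /g /h /=; congr pair.
    apply/val_inj => /=; rewrite /thead (tnth_nth x)/=.
    by case: t => -[|y s] _ //=; rewrite belast_rcons.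
  rewrite /thead (tnth_nth x)/=.
  by case: t => -[|y s] _ //=; rewrite last_rcons.
apply/val_inj => /=; rewrite /h /g /= -lastI /thead (tnth_nth (c 0))/=.
by case: t => -[|y s].
Qed.

(** The second hypothesis is the supermartingale inequality, with conditioning on the past replaced
    by a sum over the next letter. Summing out the last letter of each word gives the induction
    step. *)
Lemma integral_word_supermartingale (G : seq C -> R) n : (forall s, 0 <= G s) ->
    (forall s, \sum_(x : C) letter_prob x * G (rcons s x) <= G s) ->
  (\int[Pr]_w (G (word n w))%:E <= (G [::])%:E)%E.
Proof.
move=> G0 Gsup; rewrite integral_word_function// lee_fin.
elim: n => [|n ih].
  rewrite (big_pred1 [tuple]) => [|t]; first by rewrite big_nil mulr1.
  by apply/esym/eqP; exact: tuple0.
rewrite (big_tuple_rcons (fun s => G s * \prod_(x <- s) letter_prob x)).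
apply: le_trans ih; apply: ler_sum => t _.
under [leLHS]eq_bigr do rewrite big_rcons/= mulrCA (mulrC (G _)).
rewrite -mulr_sumr [leRHS]mulrC ler_wpM2l//.
by apply: prodr_ge0 => *; exact: letter_prob_ge0.
Qed.

Lemma sum_letter_prob : \sum_(x : C) letter_prob x = 1.
Proof.
(* The integral of the constant 1, expanded over words of length 1, is the sum sought. *)
have := @integral_word_function (fun=> 1) 1 (fun=> ler01).
rewrite integral_cst//= mul1e probability_setT => -[->].
rewrite (big_tuple_rcons (fun s => 1 * \prod_(x <- s) letter_prob x)).
rewrite (big_pred1 [tuple]) => [|t]; last by apply/esym/eqP; exact: tuple0.
by apply: eq_bigr => x _; rewrite mul1r big_seq1.
Qed.

(** [f s x] is the factor contributed by the letter [x] after the past [s]. The default [c 0] is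
    never read, as [k] stays below the size. *)
Definition wprod (f : seq C -> C -> R) (s : seq C) : R :=
  \prod_(k < size s) f (take k s) (nth (c 0) s k).

Lemma wprod_rcons f s x : wprod f (rcons s x) = wprod f s * f s x.
Proof.
rewrite /wprod size_rcons big_ord_recr/=.
rewrite nth_rcons ltnn eqxx -cats1 take_size_cat//; congr (_ * _).
by apply: eq_bigr => i _; rewrite takel_cat 1?ltnW// nth_cat ltn_ord.
Qed.

Lemma wprod_ge0 f s : (forall s x, 0 <= f s x) -> 0 <= wprod f s.
Proof. by move=> f0; exact: prodr_ge0. Qed.

Lemma wprod_word f n w :
  wprod f (word n w) = \prod_(k < n) f (word k w) (c (X k w)).
Proof.
rewrite /wprod size_word; apply: eq_bigr => k _.
rewrite -map_take take_iota (minn_idPl (ltnW _))//.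
by rewrite (nth_map 0%N) ?size_iota// nth_iota.
Qed.

Lemma integral_wprod f n : (forall s x, 0 <= f s x) ->
    (forall s, \sum_(x : C) letter_prob x * f s x <= 1) ->
  (\int[Pr]_w (\prod_(k < n) f (word k w) (c (X k w)))%:E <= 1)%E.
Proof.
move=> f0 f1; under eq_integral do rewrite -wprod_word.
have -> : 1%E = (wprod f [::])%:E by rewrite /wprod big_ord0.
apply: integral_word_supermartingale => s; first exact: wprod_ge0.
under eq_bigr do rewrite wprod_rcons mulrCA.
by rewrite -mulr_sumr ler_piMr// wprod_ge0.
Qed.

Lemma measurable_wprod (f : seq C -> C -> R) n :
  measurable_fun setT (fun w => \prod_(k < n) f (word k w) (c (X k w))).
Proof.
rewrite (_ : (fun _ => _) = fun w => wprod f (word n w)); last first.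
  by apply/funext => w; rewrite wprod_word.
exact: measurable_word_function.
Qed.

End words.

(** * Markov's inequality and Borel-Cantelli *)

Section moderate_growth.
Context (R : realType) (d : measure_display) (T : measurableType d).
Context (Pr : probability T R).

(** Induction step for bounding the partial sums of 1/n^2: the increment 2/(x(x+1)) of the
    right-hand side covers 1/x^2 as soon as x is at least 1. *)
Lemma inv_sqr_telescope (x : R) : 1 <= x ->
  3 - 2 / x + x ^- 2 <= 3 - 2 / (x + 1).
Proof.
move=> x1; rewrite -subr_ge0.
have -> : 3 - 2 / (x + 1) - (3 - 2 / x + x ^- 2) =
  (x - 1) / (x ^+ 2 * (x + 1)) by field; lra.
by rewrite divr_ge0 ?mulr_ge0 ?sqr_ge0//; lra.
Qed.

(** Extended values allow one statement for the finite products and for the infinite series [J]. *)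
Lemma ae_eventually_le_sqr (Z : nat -> T -> \bar R) :
    (forall n, measurable_fun setT (Z n)) -> (forall n w, (0 <= Z n w)%E) ->
    (forall n, (\int[Pr]_w Z n w <= 1)%E) ->
  {ae Pr, forall w, \forall n \near \oo, (Z n w <= (n%:R ^+ 2)%:E)%E}.
Proof.
move=> mZ Z0 Z1.
pose F n := [set w | ((n%:R ^+ 2)%:E <= Z n w)%E].
have mF n : measurable (F n).
  by rewrite -[F n]setTI; exact: emeasurable_fun_c_infty.
have PF n : (Pr (F n.+1) <= (n.+1%:R ^- 2)%:E)%E.
  have n0 : 0 < n.+1%:R ^+ 2 :> R by rewrite exprn_gt0.
  have := le_trans (@le_integral_comp_abse _ _ _ Pr _ measurableT (Z n.+1)
    (n.+1%:R ^+ 2) id (@measurable_id _ _ _) (fun r h => h) _ (mZ n.+1) n0) _.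
  rewrite setTI (_ : [set x | _] = F n.+1); last first.
    by apply/seteqP; split => w; rewrite /F/= gee0_abs.
  move=> /(_ 1%E) H.
  have {H} : ((n.+1%:R ^+ 2)%:E * Pr (F n.+1) <= 1)%E.
    apply: H => //; under eq_integral do rewrite gee0_abs//.
    exact: Z1.
  rewrite -(@fineK _ (Pr (F n.+1))) ?fin_num_measure// -EFinM !lee_fin => H.
  by rewrite -[leRHS]mul1r ler_pdivlMr// mulrC.
have sumF : (\sum_(n <oo) Pr (F n) <= 3%:E)%E.
  apply: lime_le; first by apply: is_cvg_nneseries => n _ _; exact: measure_ge0.
  exists 1%N => // -[//|n] _ /=.
  apply: (@le_trans _ _ (3 - 2 / n.+1%:R)%:E); last first.
    by rewrite lee_fin gerDl oppr_le0 divr_ge0.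
  elim: n => [|n ih].
    (* [F 0] is the whole space, so it gets the trivial bound 1 = 3 - 2/1; this fixes the constant
       3. *)
    by rewrite big_nat1 (le_trans (probability_le1 _ (mF _)))// lee_fin; lra.
  rewrite big_nat_recr//=.
  apply: (le_trans (leeD ih (PF n))); rewrite -EFinD lee_fin.
  have : 1 <= n.+1%:R :> R by rewrite ler1n.
  rewrite -[n.+2%:R]natr1; set x : R := n.+1%:R => x1.
  exact: inv_sqr_telescope.
have F0 := lim_sup_set_cvg0 mF (le_lt_trans sumF (ltry _)).
exists (lim_sup_set F); split => //.
  by apply: bigcap_measurable => // k _; apply: bigcup_measurable.
move=> w /= nw n _ /=; apply: contrapT => Fn; apply: nw.
exists n => // k /= nk; rewrite leNgt; apply/negP => Zk; apply: Fn.
by exists k => //; rewrite /F/= ltW.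
Qed.

End moderate_growth.

(** * Almost sure behaviour of frequencies and e-processes *)

Section indicators.
Context (R : realType) (d : measure_display) (T : measurableType d).
Context (Pr : probability T R) (P : probability int R).
Context (X : nat -> {RV Pr >-> int}) (iidX : iid P X).

Lemma sum_letter_prob_indicator (C : finType) (c : int -> C) (x0 : C) :
  \sum_(x : C) letter_prob P c x * (x == x0)%:R = letter_prob P c x0.
Proof.
rewrite (bigD1 x0)//= eqxx mulr1 big1 ?addr0// => x /negbTE->.
by rewrite mulr0.
Qed.

Lemma pmfZ_bounds (a : int) : 0 <= pmfZ P a <= 1.
Proof.
by rewrite fine_ge0//= -lee_fin fineK ?fin_num_measure ?probability_le1.
Qed.

(** Over the alphabet [bool], the factors [1 + mu * (x - p)] have mean exactly 1 for either sign of
    [mu], and they are nonnegative because [mu] lies in [-1, 1] and [p] in [0, 1]. Hence both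
    products grow at most like n^2. *)
Lemma ae_mean_indicator (a : int) :
  {ae Pr, forall w, arithmetic_mean (fun k => (X k w == a)%:R) @ \oo --> pmfZ P a}.
Proof.
set p := pmfZ P a; have p01 := pmfZ_bounds a.
have H j (b : bool) : {ae Pr, forall w, \forall n \near \oo,
    \prod_(0 <= k < n) (1 + (-1) ^+ b * j.+2%:R^-1 * ((X k w == a)%:R - p)) <=
    n%:R ^+ 2}.
  pose mu : R := (-1) ^+ b * j.+2%:R^-1.
  pose c (z : int) : bool := z == a.
  pose f (s : seq bool) (x : bool) : R := 1 + mu * (x%:R - p).
  have mu1 : - 1 <= mu <= 1.
    have j0 : 0 < j.+2%:R^-1 :> R by rewrite invr_gt0.
    have j1 : j.+2%:R^-1 <= 1 :> R by rewrite invf_le1// ler1n.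
    rewrite /mu; move: (j.+2%:R^-1) j0 j1 => i i0 i1.
    by case: (b); rewrite ?expr1 ?expr0; lra.
  have f0 s x : 0 <= f s x by rewrite /f; case: x => /=; move: p01; rewrite -/p; nra.
  have f1 s : \sum_(x : bool) letter_prob P c x * f s x <= 1.
    rewrite /f (eq_bigr (fun x => letter_prob P c x * (1 - mu * p) +
      mu * (letter_prob P c x * (x == true)%:R))) => [|x _]; last first.
      by rewrite eqb_id; ring.
    rewrite big_split/= -mulr_suml -mulr_sumr sum_letter_prob_indicator.
    rewrite (sum_letter_prob iidX).
    have -> : letter_prob P c true = p.
      congr (fine (P _)); apply/seteqP; split => z; rewrite /c /=.
        by move/eqP.
      by move=> ->; rewrite eqxx.
    lra.
  pose Z n w := (\prod_(k < n) f (word X c k w) (c (X k w)))%:E.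
  have mZ n : measurable_fun setT (Z n).
    by apply/measurable_EFinP; exact: measurable_wprod.
  have Z0 n w : (0 <= Z n w)%E by rewrite lee_fin prodr_ge0.
  have Z1 n : (\int[Pr]_w Z n w <= 1)%E by exact: (integral_wprod iidX n f0 f1).
  apply: filterS (ae_eventually_le_sqr mZ Z0 Z1) => w.
  by apply: filterS => n; rewrite lee_fin big_mkord.
have {H} H : {ae Pr, forall w, forall j, forall b : bool, \forall n \near \oo,
    \prod_(0 <= k < n) (1 + (-1) ^+ b * j.+2%:R^-1 * ((X k w == a)%:R - p)) <=
    n%:R ^+ 2}.
  by apply: ae_foralln => j; apply: filterS2 (H j true) (H j false) => w ? ? [].
apply: filterS H => w Hw; apply: arithmetic_mean_cvg_of_eprods => // k.
by case: eqP => _; rewrite ?lexx ler01.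
Qed.

Lemma disjoint_indicators_eq (a b : int) (x : nat -> int) : a != b ->
  disjoint_indicators (fun k => (x k == a)%:R : R) (fun k => (x k == b)%:R : R).
Proof.
move=> ab k; split.
- by case: eqP; [right|left].
- by case: eqP; [right|left].
- by case: eqP => [->|_]; rewrite ?mul0r// (negbTE ab) mulr0.
Qed.

Section pair.
Variables (a b : int).
Hypothesis ab : a != b.

(** Three letters suffice: a hit of [a], a hit of [b], and [None] for everything else. *)
Let c (z : int) : option bool :=
  if z == a then Some false else if z == b then Some true else None.

Let cF z : (c z == Some false) = (z == a).
Proof. by rewrite /c; case: (z == a) => //; case: (z == b). Qed.

Let cT z : (c z == Some true) = (z == b).
Proof.
rewrite /c; have [->|_] := eqVneq z a; first by rewrite (negbTE ab).
by case: (z == b).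
Qed.

Let tally (x : option bool) (s : seq (option bool)) : R :=
  \sum_(y <- s) (y == x)%:R.

Let f (s : seq (option bool)) (x : option bool) : R :=
  1 + lam (tally (Some false) s) (tally (Some true) s) *
      ((x == Some true)%:R - (x == Some false)%:R).

Let tally_ge0 x s : 0 <= tally x s.
Proof. exact: sumr_ge0. Qed.

Let f_ge0 s x : 0 <= f s x.
Proof.
have := lam_ge0 (tally_ge0 (Some false) s) (tally_ge0 (Some true) s).
have := lam_le_half (tally_ge0 (Some false) s) (tally_ge0 (Some true) s).
by rewrite /f; case: x => [[]|] /=; lra.
Qed.

Let eproc_word n w :
  eproc (fun k => (X k w == a)%:R) (fun k => (X k w == b)%:R) n =
  \prod_(k < n) f (word X c k w) (c (X k w)).
Proof.
rewrite /eproc big_mkord; apply: eq_bigr => k _.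
rewrite /f cF cT /tally /word !big_map; congr (1 + lam _ _ * _).
- by rewrite /series/= /index_iota subn0; apply: eq_bigr => i _; rewrite cF.
- by rewrite /series/= /index_iota subn0; apply: eq_bigr => i _; rewrite cT.
Qed.

Lemma measurable_eproc n : measurable_fun setT (fun w =>
  eproc (fun k => (X k w == a)%:R : R) (fun k => (X k w == b)%:R) n).
Proof. by under eq_fun do rewrite eproc_word; exact: measurable_wprod. Qed.

(** Given the past, the next factor has mean [1 + l * (pmfZ P b - pmfZ P a)], where [l] is
    nonnegative and known from the past. *)
Lemma integral_eproc_le1 n : pmfZ P b <= pmfZ P a ->
  (\int[Pr]_w (eproc (fun k => (X k w == a)%:R : R) (fun k => (X k w == b)%:R) n)%:E
    <= 1)%E.
Proof.
move=> pba; under eq_integral do rewrite eproc_word.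
apply: (integral_wprod iidX) => // s; rewrite /f.
have l0 := lam_ge0 (tally_ge0 (Some false) s) (tally_ge0 (Some true) s).
set l := lam _ _ in l0 *.
under eq_bigr do rewrite mulrDr mulr1 mulrCA mulrBr.
rewrite big_split/= (sum_letter_prob iidX) -mulr_sumr sumrB.
rewrite !sum_letter_prob_indicator.
have -> : letter_prob P c (Some true) = pmfZ P b.
  congr (fine (P _)); apply/seteqP; split => z /=.
    by move=> cz; apply/eqP; rewrite -cT cz.
  by move/eqP; rewrite -cT => /eqP.
have -> : letter_prob P c (Some false) = pmfZ P a.
  congr (fine (P _)); apply/seteqP; split => z /=.
    by move=> cz; apply/eqP; rewrite -cF cz.
  by move/eqP; rewrite -cF => /eqP.
by nra.
Qed.

End pair.

(** The free constant [C] will absorb the weight of a single summand of [J]. *)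
Lemma ae_eproc_large (a b : int) : pmfZ P a < pmfZ P b ->
  {ae Pr, forall w, forall C : R, \forall n \near \oo, C * n%:R ^+ 2 <
    eproc (fun k => (X k w == a)%:R) (fun k => (X k w == b)%:R) n}.
Proof.
move=> pab; have ab : a != b by apply: contraTneq pab => ->; rewrite ltxx.
apply: filterS2 (ae_mean_indicator a) (ae_mean_indicator b) => w wa wb C.
apply: (eproc_large _ (disjoint_indicators_eq _ ab) _ pab wa wb).
by have /andP[] := pmfZ_bounds a.
Qed.

End indicators.

(** * Membership of a single integer in the confidence set *)

Section modes.
Context (R : realType) (d : measure_display) (T : measurableType d).
Context (Pr : probability T R) (P : probability int R).
Context (X : nat -> {RV Pr >-> int}) (iidX : iid P X).
Variable theta : int.

Let succ_neq (m : nat) : theta + m%:Z != theta + m%:Z + 1.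
Proof. by apply/eqP; lia. Qed.

Let pred_neq (m : nat) : theta - m%:Z != theta - m%:Z - 1.
Proof. by apply/eqP; lia. Qed.

Lemma Jplus_ge0 x n m : 0 <= Jplus R x n m theta.
Proof. by rewrite JplusE; exact/eproc_ge0/disjoint_indicators_eq/succ_neq. Qed.

Lemma Jminus_ge0 x n m : 0 <= Jminus R x n m theta.
Proof. by rewrite JminusE; exact/eproc_ge0/disjoint_indicators_eq/pred_neq. Qed.

Lemma measurable_Jplus n m :
  measurable_fun setT (fun w => Jplus R (fun i => X i w) n m theta).
Proof. by under eq_fun do rewrite JplusE; exact/measurable_eproc/succ_neq. Qed.

Lemma measurable_Jminus n m :
  measurable_fun setT (fun w => Jminus R (fun i => X i w) n m theta).
Proof. by under eq_fun do rewrite JminusE; exact/measurable_eproc/pred_neq. Qed.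

Let weight_ge0 (m : nat) : 0 <= 2 ^- m :> R.
Proof. by rewrite invr_ge0; apply: exprn_ge0. Qed.

Let term_ge0 x n m :
  (0 <= (2 ^- m.+2 * (Jplus R x n m theta + Jminus R x n m theta))%:E)%E.
Proof.
rewrite lee_fin; apply: mulr_ge0; first exact: weight_ge0.
by apply: addr_ge0; [exact: Jplus_ge0|exact: Jminus_ge0].
Qed.

Let measurable_term n m : measurable_fun setT (fun w =>
  (2 ^- m.+2 * (Jplus R (fun i => X i w) n m theta +
                Jminus R (fun i => X i w) n m theta))%:E).
Proof.
apply/measurable_EFinP; apply: measurable_funM => //; apply: measurable_funD.
- exact: measurable_Jplus.
- exact: measurable_Jminus.
Qed.

Lemma integral_J_le1 n : modes P theta ->
  (\int[Pr]_w J R (fun i => X i w) n theta <= 1)%E.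
Proof.
move=> [up down].
have Jp1 m : (\int[Pr]_w (Jplus R (fun i => X i w) n m theta)%:E <= 1)%E.
  under eq_integral do rewrite JplusE.
  by apply: (integral_eproc_le1 iidX (succ_neq m)); apply: down; lia.
have Jm1 m : (\int[Pr]_w (Jminus R (fun i => X i w) n m theta)%:E <= 1)%E.
  under eq_integral do rewrite JminusE.
  by apply: (integral_eproc_le1 iidX (pred_neq m)); apply: up; lia.
rewrite /J integral_nneseries//.
(* The two processes of index m contribute at most 2 * 2^-(m+2) = 2^-(m+1), and these bounds sum to
   1. *)
have -> : 1%E = (\sum_(0 <= m <oo) (1 / (2 ^ (m + 1))%:R)%:E)%E :> \bar R.
  apply/esym/cvg_lim => //.
  by have := @cvg_geometric_eseries_half R 1 0; rewrite expr0 divr1.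
apply: lee_nneseries => [m _ _|m _]; first exact: integral_ge0.
under eq_integral do rewrite EFinM EFinD.
rewrite ge0_integralZl_EFin//; last 2 first.
- by move=> w _; apply: adde_ge0; rewrite lee_fin; [exact: Jplus_ge0|exact: Jminus_ge0].
- by apply: emeasurable_funD; apply/measurable_EFinP;
    [exact: measurable_Jplus|exact: measurable_Jminus].
rewrite ge0_integralD//; last 4 first.
- by move=> w _; rewrite lee_fin; exact: Jplus_ge0.
- exact/measurable_EFinP/measurable_Jplus.
- by move=> w _; rewrite lee_fin; exact: Jminus_ge0.
- exact/measurable_EFinP/measurable_Jminus.
apply: (@le_trans _ _ ((2 ^- m.+2)%:E * (1 + 1))%E).
  by apply: lee_wpmul2l; [rewrite lee_fin; exact: weight_ge0|exact: leeD].
rewrite -EFinD -EFinM lee_fin natrX addn1 exprS invfM.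
have -> : 1 + 1 = 2 :> R by [].
by rewrite mulrAC mulVf// !mul1r.
Qed.

Lemma J_ge_Jplus x n m :
  ((2 ^- m.+2 * Jplus R x n m theta)%:E <= J R x n theta)%E.
Proof.
apply: le_trans (nneseries_lim_ge m.+1 (fun k _ _ => term_ge0 x n k)).
rewrite big_nat_recr//= -[leLHS]add0e; apply: leeD.
  by apply: sume_ge0 => k _; exact: term_ge0.
by rewrite lee_fin; apply: ler_wpM2l; rewrite ?weight_ge0// lerDl; exact: Jminus_ge0.
Qed.

Lemma J_ge_Jminus x n m :
  ((2 ^- m.+2 * Jminus R x n m theta)%:E <= J R x n theta)%E.
Proof.
apply: le_trans (nneseries_lim_ge m.+1 (fun k _ _ => term_ge0 x n k)).
rewrite big_nat_recr//= -[leLHS]add0e; apply: leeD.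
  by apply: sume_ge0 => k _; exact: term_ge0.
by rewrite lee_fin; apply: ler_wpM2l; rewrite ?weight_ge0// lerDr; exact: Jplus_ge0.
Qed.

Lemma ae_mode_in_Mhat : modes P theta ->
  {ae Pr, forall w, \forall n \near \oo, Mhat R (fun i => X i w) n theta}.
Proof.
move=> Mtheta; apply: ae_eventually_le_sqr => n.
- exact: ge0_emeasurable_sum.
- by move=> w; exact: nneseries_ge0.
- exact: integral_J_le1.
Qed.

Lemma ae_not_mode_notin_Mhat : ~ modes P theta ->
  {ae Pr, forall w, \forall n \near \oo, ~ Mhat R (fun i => X i w) n theta}.
Proof.
move=> notM.
have : (exists m : nat, pmfZ P (theta + m%:Z) < pmfZ P (theta + m%:Z + 1)) \/
       (exists m : nat, pmfZ P (theta - m%:Z) < pmfZ P (theta - m%:Z - 1)).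
  (* With no wrongly ordered pair on either side, every n satisfies its monotonicity condition, with
     m the distance from n to [theta]. *)
  apply: contrapT => /not_orP[/forallNP up /forallNP down]; apply: notM; split.
    move=> n nt; rewrite leNgt; apply/negP => pn.
    by apply: (down `|theta - n|%N); rewrite (_ : theta - _ = n)//; lia.
  move=> n nt; rewrite leNgt; apply/negP => pn.
  by apply: (up `|n - theta|%N); rewrite (_ : theta + _ = n)//; lia.
(* Taking [C] to be the inverse of the weight makes this one summand exceed n^2, and the other terms
   of [J] are nonnegative. *)
move=> [[m pm]|[m pm]]; apply: filterS (ae_eproc_large iidX pm) => w /(_ (2 ^+ m.+2));
    apply: filterS => n; (rewrite -ltr_pdivlMl; last by apply: exprn_gt0); move=> large;
    apply/negP; rewrite -ltNge.
- by apply: lt_le_trans (J_ge_Jplus _ _ m); rewrite lte_fin JplusE.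
- by apply: lt_le_trans (J_ge_Jminus _ _ m); rewrite lte_fin JminusE.
Qed.

Lemma ae_Mhat_eventually_modes : {ae Pr, forall w, \forall n \near \oo,
  Mhat R (fun i => X i w) n theta <-> modes P theta}.
Proof.
have [M|M] := pselect (modes P theta).
  by apply: filterS (ae_mode_in_Mhat M) => w; apply: filterS.
by apply: filterS (ae_not_mode_notin_Mhat M) => w; apply: filterS.
Qed.

End modes.

(** * From single integers to bounded sets *)

Unset Implicit Arguments.

Theorem corollary2p8 (R : realType) (d : measure_display)
    (T : measurableType d) (Pr : probability T R)
    (P : probability int R) (X : nat -> {RV Pr >-> int})
    (unimodalP : unimodal P) (iidX : iid P X) :
  {ae Pr, forall w : T, forall B : set int, boundedZ B ->
    exists N : nat, forall n : nat, (N <= n)%N ->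
      Mhat R (fun i => X i w) n `&` B = modes P `&` B}.
Proof.
pose Q theta w := \forall n \near \oo,
  Mhat R (fun i => X i w) n theta <-> modes P theta.
(* The integers are countable, so one null set serves all of them; the two constructors reduce this
   to an intersection over [nat]. *)
have : {ae Pr, forall w, forall k : nat, Q k%:Z w /\ Q (Negz k) w}.
  apply: ae_foralln => k.
  by apply: filterS2 (ae_Mhat_eventually_modes iidX k%:Z)
    (ae_Mhat_eventually_modes iidX (Negz k)) => w ? ?.
apply: filterS => w Qw B [K BK].
have {}Qw theta : exists N : nat, forall n : nat, (N <= n)%N ->
    Mhat R (fun i => X i w) n theta <-> modes P theta.
  have [N _ HN] : Q theta w by case: theta => k; case: (Qw k).
  by exists N.
have [N HN] := choice Qw.
pose k : nat := `|K|%N.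
(* [B] lies in [-k, k], whose 2k + 1 integers are the i - k; the largest of their thresholds works
   for all of them. *)
exists (\max_(i < k.*2.+1) N (Posz i - Posz k)%R) => n Nn.
have {}HN theta : B theta -> Mhat R (fun i => X i w) n theta <-> modes P theta.
  move=> /BK thetaK; apply: HN; apply: leq_trans Nn.
  have ilt : (`|(theta + Posz k)%R| < k.*2.+1)%N by lia.
  apply: leq_trans (leq_bigmax (Ordinal ilt)).
  by rewrite /= (_ : _ - _ = theta)//; lia.
by apply/seteqP; split => theta [+ Bt]; rewrite /= => h; split => //; apply/HN.
Qed.
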